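(* Let $(\mathcal{D},\epsilon)$ be a tensor manifold. Let $I_2$ and $O_2$ be linear partitions, and let $I_1$ and $O_1$ be linear partitions of $I_2$ and $O_2$ respectively (i.e. of their linearly ordered sets of blocks). Then $$\ast^{I_1}_{O_1}\circ\ast^{I_2}_{O_2}=\ast^{I_1\triangleleft I_2}_{O_1\triangleleft O_2}$$ as maps $Mor(\mathcal{D})\to Mor(\mathcal{D})$.
   Context: Planar graphs. A graph is a triple $(H,P,\sigma)$ with $H$ a finite set (half-edges), $P$ a partition of $H$ into nonempty blocks (vertices), $\sigma$ an involution of $H$ (its orbits are the edges), such that a vertex containing a two-element $\sigma$-orbit equals that orbit; such vertices and edges are called virtual, all other vertices real. A leg is a half-edge fixed by $\sigma$ (real leg) or lying in a virtual edge (virtual leg). An orientation $\mathrm{sgn}:H\to\{+,-\}$ takes different values on the two elements of each two-element orbit; $In(v),Out(v)$ (resp. $In(\Gamma),Out(\Gamma)$) are the sets of half-edges in $v$ (resp. of legs) of sign $+$, $-$. The graph is directed if all $In(v),Out(v)$ are nonempty. The source (target) of an edge is the vertex containing its $-$ ($+$) half-edge, if there is one; $e\to e'$ means there are edges $e=e_1,\dots,e_n=e'$, $n\ge 1$, with the target of $e_i$ equal to the source of $e_{i+1}$. A planar graph is a directed graph with a linear order $\prec$ on its edges such that for all distinct edges: $e_1\to e_2$ implies $e_1\prec e_2$; and if $e_1\to e_2$ and $e_1\prec e_3\prec e_2$ then $e_1\to e_3$ or $e_3\to e_2$. The sets $In(\cdot)$, $Out(\cdot)$ are ordered by $\prec$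 applied to the edges containing their elements. A graph is unitary if it consists of exactly one virtual vertex; prime if it has exactly one vertex and is not unitary. $\Gamma_1\otimes\Gamma_2$ is the disjoint union, with all edges of $\Gamma_1$ preceding those of $\Gamma_2$. If $Out(\Gamma_1)=\{o_1,\dots,o_n\}$ and $In(\Gamma_2)=\{i_1,\dots,i_n\}$ in increasing order, $\Gamma_2\circ\Gamma_1$ is obtained from the disjoint union by grafting $o_k$ to $i_k$ for each $k$: if both are real legs, join them into an edge $\bar e_k=\{o_k,i_k\}$; if exactly one is virtual, delete its virtual edge, the edge of the other being $\bar e_k$; if both are virtual, delete $o_k,i_k$ and let $\bar e_k=\{\sigma_1(o_k),\sigma_2(i_k)\}$ be a virtual edge (and a virtual vertex). The order of edges is $A_1,\bar e_1,B_1,\dots,A_n,\bar e_n,B_n$, where $A_k$ is the set of edges of $\Gamma_1$ strictly between the edges of $o_{k-1}$ and $o_k$ (before that of $o_1$ if $k=1$) and $B_k$ the set of edges of $\Gamma_2$ strictly between the edges of $i_k$ and $i_{k+1}$ (after that of $i_n$ if $k=n$), each with its own order. Tensor manifolds. $W(S)$ is the set of words (including the empty one) in $S$. A tensor scheme $\mathcal{D}$ consists of sets $Ob(\mathcal{D})$, $Mor(\mathcal{D})$ and maps $s,t:Mor(\mathcal{D})\to W(Ob(\mathcal{D}))$ whose values are nonempty words; morphisms of tensor schemes are pairs of maps $(\varphi_o,\varphi_m)$ compatible with $s,t$. A diagram in $\mathcal{D}$ is a planar graph $\Gamma$ with a $\sigma$-invariant map $\gamma_o$ from half-edges to $Ob(\mathcal{D})$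 and a map $\gamma_m$ from real vertices to $Mor(\mathcal{D})$ such that $s(\gamma_m(v))$, $t(\gamma_m(v))$ are the words of values of $\gamma_o$ along $In(v)$, $Out(v)$; its domain and codomain are the words along $In(\Gamma)$, $Out(\Gamma)$. Diagrams are taken up to bijections of half-edges preserving all structure; tensor product and composition are those of planar graphs with inherited decorations; they form a strict monoidal category $F(\mathcal{D})$ with objects $W(Ob(\mathcal{D}))$ under concatenation, identities being tensor products of unitary diagrams. $T(\mathcal{D})$ is the tensor scheme with $Ob(T(\mathcal{D}))=W(Ob(\mathcal{D}))$ whose morphisms are bracketed diagrams $(w_1\cdots w_m;u_1\cdots u_n;\Gamma)$, $m,n\ge1$, with $w_i,u_j\in W(Ob(\mathcal{D}))$ and $\Gamma$ a diagram in $\mathcal{D}$ with domain the concatenation of the $w_i$ and codomain that of the $u_j$; source $w_1\cdots w_m$, target $u_1\cdots u_n$ (words in words). $T$ acts on morphisms by relabelling. $\eta_{\mathcal{D}}:\mathcal{D}\to T(\mathcal{D})$ sends $x$ to the one-letter word $(x)$ and $f:x_1\cdots x_m\to y_1\cdots y_n$ to $((x_1)\cdots(x_m);(y_1)\cdots(y_n);\Gamma_f)$, with $\Gamma_f$ the prime diagram with vertex decorated by $f$. $\mu_{\mathcal{D}}:TT(\mathcal{D})\to T(\mathcal{D})$ concatenates words of words and sends a bracketed diagram $\Delta$ in $T(\mathcal{D})$ to its value in $F(\mathcal{D})$ (the diagram in $\mathcal{D}$ obtained by tensoring and composing, as prescribed by $\Delta$, the diagrams decorating its vertices), each bracket being concatenated.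 A tensor manifold is an algebra $(\mathcal{D},\epsilon)$ of the monad $(T,\mu,\eta)$: a morphism of tensor schemes $\epsilon=(\epsilon_o,\epsilon_m):T(\mathcal{D})\to\mathcal{D}$ with $\epsilon\circ T(\epsilon)=\epsilon\circ\mu_{\mathcal{D}}$ and $\epsilon\circ\eta_{\mathcal{D}}=Id$. Fusion. A linear partition $I=I_1'<\cdots<I_s'$ is a partition of a finite linearly ordered set into nonempty consecutive segments (blocks), which are linearly ordered; $|I|=s$ is the number of blocks and $\|I\|$ the number of elements of the underlying set. If $P$ is a linear partition of the ordered set of blocks of $Q$, then $P\triangleleft Q$ is the linear partition of the underlying set of $Q$ whose blocks are the unions of the blocks of $Q$ lying in a common block of $P$. For a pair $(I,O)$ of linear partitions, the fusion $\ast^I_O:Mor(\mathcal{D})\to Mor(\mathcal{D})$ is defined on $f:x_1\cdots x_m\to y_1\cdots y_n$ as follows: if $m=\|I\|$ and $n=\|O\|$, then $\ast^I_O(f)=\epsilon_m$ of the prime diagram $\Gamma_f$ with domain $x_1\cdots x_m$ and codomain $y_1\cdots y_n$ bracketed into consecutive words according to $I$ and $O$; otherwise $\ast^I_O(f)=\epsilon_m(\varnothing)$, the image of the empty diagram (with domain and codomain bracketed as a single empty word), which equals $Id_{1_{\mathcal{D}}}$, the image of the unitary diagram labelled by $1_{\mathcal{D}}=\epsilon_o(\varnothing)$ bracketed $(1_{\mathcal{D}})$, $(1_{\mathcal{D}})$. *)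

(* Defs.v *)
(* A finite linearly ordered set is encoded throughout as the duplicate-free
   list of its elements in increasing order. *)
From HB Require Import structures.
From mathcomp Require Import all_boot.
From mathcomp Require Import boolp.

Set Implicit Arguments.
Unset Strict Implicit.
Unset Printing Implicit Defensive.

Section Quotient.
Variables (T : Type) (R : T -> T -> Prop).

(* An element is an R-class; only used when R is an equivalence. *)
Record quot := Quot { cls : T -> Prop; clsP : exists x, cls = R x }.

Definition class (x : T) : quot := Quot (ex_intro _ x (erefl (R x))).

Definition repr (c : quot) : T := projT1 (cid (clsP c)).

Lemma repr_class (x : T) : (forall y, R y y) -> R x (repr (class x)).
Proof.
move=> Rxx; rewrite /repr; case: cid => y /= ->; exact: Rxx.
Qed.

End Quotient.

Record graph := Graph {
  half :> finType;
  verts : {set {set half}};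
  opp : half -> half;
  verts_partition : partition verts [set: half];
  opp_involutive : involutive opp;
  verts_virtual : forall v h, v \in verts -> opp h != h ->
    h \in v -> opp h \in v -> v = [set h; opp h]
}.

Section GraphTheory.
Variable G : graph.
Implicit Types (h : G) (v e : {set G}).

Definition edge_of h : {set G} := [set h; opp h].

Definition edges : {set {set G}} := [set edge_of h | h in G].

(* A virtual vertex and its virtual edge are the same set of half-edges. *)
Definition virtual v : bool :=
  (v \in verts G) && [exists h in v, (opp h != h) && (v == edge_of h)].

Definition real_vertex v : bool := (v \in verts G) && ~~ virtual v.

Definition virtual_leg h : bool := virtual (edge_of h).

Definition leg h : bool := (opp h == h) || virtual_leg h.

End GraphTheory.

(* true is the sign +, false is the sign - *)
Definition orientation (G : graph) (sgn : G -> bool) : Prop :=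
  forall h, opp h != h -> sgn (opp h) != sgn h.

Section Oriented.
Variables (G : graph) (sgn : G -> bool).

Definition in_of (v : {set G}) : {set G} := [set h in v | sgn h].
Definition out_of (v : {set G}) : {set G} := [set h in v | ~~ sgn h].
Definition in_legs : {set G} := [set h | leg h & sgn h].
Definition out_legs : {set G} := [set h | leg h & ~~ sgn h].

Definition directed : Prop :=
  forall v, v \in verts G -> in_of v != set0 /\ out_of v != set0.

Definition target (e v : {set G}) : bool :=
  (v \in verts G) && [exists h in e, sgn h && (h \in v)].
Definition source (e v : {set G}) : bool :=
  (v \in verts G) && [exists h in e, ~~ sgn h && (h \in v)].

Definition step (e e' : {set G}) : bool :=
  [&& e \in edges G, e' \in edges G & [exists v, target e v && source e' v]].

Definition reach (e e' : {set G}) : bool := connect step e e'.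

End Oriented.

(* x strictly precedes y in the ordered set listed by s *)
Definition before (T : eqType) (s : seq T) (x y : T) : bool :=
  index x s < index y s.

Record planar_graph := PlanarGraph {
  pg_graph :> graph;
  sgn : pg_graph -> bool;
  edge_seq : seq {set pg_graph};
  sgnP : orientation sgn;
  pg_directed : directed sgn;
  edge_seq_uniq : uniq edge_seq;
  mem_edge_seq : edge_seq =i edges pg_graph;
  reach_before : {in edges pg_graph &, forall e1 e2,
    e1 != e2 -> reach sgn e1 e2 -> before edge_seq e1 e2};
  before_between : {in edges pg_graph & &, forall e1 e2 e3,
    [&& e1 != e2, e1 != e3 & e3 != e2] -> reach sgn e1 e2 ->
    before edge_seq e1 e3 -> before edge_seq e3 e2 ->
    reach sgn e1 e3 || reach sgn e3 e2}
}.

Section PlanarTheory.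
Variable G : planar_graph.

Definition pos (h : G) : nat := index (edge_of h) (edge_seq G).

(* The elements of S, ordered by the edges containing them. *)
Definition along (S : {set G}) : seq G :=
  sort (fun h h' => pos h <= pos h') (enum S).

Definition In (v : {set G}) : seq G := along (in_of (@sgn G) v).
Definition Out (v : {set G}) : seq G := along (out_of (@sgn G) v).
Definition InG : seq G := along (in_legs (@sgn G)).
Definition OutG : seq G := along (out_legs (@sgn G)).

Definition unitary_graph : Prop := exists2 v, verts G = [set v] & virtual v.
Definition prime_graph : Prop := #|verts G| = 1 /\ ~ unitary_graph.

End PlanarTheory.

Record tensor_scheme := TensorScheme {
  Ob : Type;
  Mor : Type;
  src : Mor -> seq Ob;
  tgt : Mor -> seq Ob;
  src_gt0 : forall f, 0 < size (src f);
  tgt_gt0 : forall f, 0 < size (tgt f)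
}.

Record scheme_hom (C D : tensor_scheme) := SchemeHom {
  hom_ob : Ob C -> Ob D;
  hom_mor : Mor C -> Mor D;
  hom_src : forall f, src (hom_mor f) = map hom_ob (src f);
  hom_tgt : forall f, tgt (hom_mor f) = map hom_ob (tgt f)
}.

Record diagram (D : tensor_scheme) := Diagram {
  dg_graph :> planar_graph;
  lab : dg_graph -> Ob D;
  dec : forall v : {set dg_graph}, real_vertex v -> Mor D;
  lab_opp : forall h, lab (opp h) = lab h;
  dec_src : forall v (rv : real_vertex v), src (dec rv) = map lab (In v);
  dec_tgt : forall v (rv : real_vertex v), tgt (dec rv) = map lab (Out v)
}.

Section DiagramTheory.
Variable D : tensor_scheme.
Implicit Types d : diagram D.

Definition ddom d : seq (Ob D) := map (@lab D d) (InG d).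
Definition dcod d : seq (Ob D) := map (@lab D d) (OutG d).

Definition diagram_iso d d' : Prop :=
  exists f : d -> d',
    [/\ bijective f,
        verts d' = [set f @: v | v : {set d} in verts d],
        forall h, f (opp h) = opp (f h),
        forall h, sgn (f h) = sgn h &
    [/\ edge_seq d' = [seq f @: e | e : {set d} <- edge_seq d],
        forall h, lab (f h) = lab h &
        forall v (rv : real_vertex v) (rv' : real_vertex (f @: v)),
          dec rv' = dec rv]].

End DiagramTheory.

Lemma sort_keyE (T : eqType) (k : T -> nat) (s t : seq T) :
  perm_eq s t -> sorted ltn (map k s) -> sort (fun x y => k x <= k y) t = s.
Proof.
move=> pst; rewrite ltn_sorted_uniq_leq => /andP[us ss].
apply: (@sorted_eq_in _ (fun x y => k x <= k y)).
- by move=> x y z _ _ _; apply: leq_trans.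
- move=> x y; rewrite !mem_sort -!(perm_mem pst) => xs ys /anti_leq kxy.
  have/(_ us) inj := @map_uniq _ _ k s.
  move: us => /(uniqP 0); rewrite size_map => U.
  have ix : index x s < size s by rewrite index_mem.
  have iy : index y s < size s by rewrite index_mem.
  have := U (index x s) (index y s) ix iy.
  rewrite !(nth_map x) // !nth_index // => /(_ kxy) ixy.
  by rewrite -(nth_index x xs) ixy nth_index.
- by apply: sort_sorted => x y; apply: leq_total.
- by rewrite sorted_map in ss.
- by rewrite perm_sort perm_sym.
Qed.

Section IsoInvariance.
Variable D : tensor_scheme.
Implicit Types d : diagram D.

Lemma diagram_iso_refl d : diagram_iso d d.
Proof.
exists id; split=> //; first by exists id.
  by rewrite (eq_imset _ (@imset_id _)) imset_id.
split=> //; first by rewrite (eq_map (@imset_id _)) map_id.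
move=> v rv; rewrite [id @: v]imset_id => rv'.
by congr (dec _); apply: bool_irrelevance.
Qed.

Lemma edge_inj_sgn d (S : {set d}) :
  {in S &, forall h h', sgn h = sgn h'} ->
  {in S &, forall h h', edge_of h = edge_of h' -> h = h'}.
Proof.
move=> same h h' hS hS' e; apply/eqP/negPn/negP => nhh'.
have : h \in edge_of h' by rewrite -e !inE eqxx.
rewrite !inE (negPf nhh') /= => /eqP hE.
have/(@sgnP d): opp h' != h' by rewrite -hE.
by rewrite -hE (same _ _ hS hS') eqxx.
Qed.

Lemma along_iso d d' (f : d -> d') (S : {set d}) :
  injective f -> (forall h, f (opp h) = opp (f h)) ->
  edge_seq d' = [seq f @: e | e : {set d} <- edge_seq d] ->
  {in S &, forall h h', sgn h = sgn h'} ->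
  along (f @: S) = map f (along S).
Proof.
move=> finj fopp fseq sS.
have posE h : pos (f h) = pos h.
  rewrite /pos fseq -(index_map (@imset_inj _ _ _ finj)); congr index.
  by rewrite /edge_of -fopp imsetU !imset_set1.
apply: sort_keyE.
  apply: uniq_perm; rewrite ?enum_uniq //.
    by rewrite map_inj_uniq // sort_uniq enum_uniq.
  move=> h; rewrite mem_enum; apply/mapP/imsetP.
    by case=> x; rewrite mem_sort mem_enum => xS ->; exists x.
  by case=> x xS ->; exists x; rewrite // mem_sort mem_enum.
rewrite -map_comp (eq_map posE) ltn_sorted_uniq_leq; apply/andP; split.
  rewrite map_inj_in_uniq ?sort_uniq ?enum_uniq // => x y.
  rewrite !mem_sort !mem_enum => xS yS pxy; apply: (edge_inj_sgn sS) => //.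
  have mem (z : d) : edge_of z \in edge_seq d.
    by rewrite mem_edge_seq; apply/imsetP; exists z.
  by rewrite -(nth_index set0 (mem x)) -/(pos x) pxy nth_index.
by rewrite sorted_map; apply: sort_sorted => x y; apply: leq_total.
Qed.

Lemma leg_iso d d' (f : d -> d') :
  injective f -> (forall h, f (opp h) = opp (f h)) ->
  verts d' = [set f @: v | v : {set d} in verts d] ->
  forall h, leg (f h) = leg h.
Proof.
move=> finj fopp fv h.
have edgeE x : edge_of (f x) = f @: edge_of x.
  by rewrite /edge_of -fopp imsetU !imset_set1.
rewrite /leg -fopp (inj_eq finj) /virtual_leg /virtual edgeE fv.
rewrite (mem_imset _ _ (imset_inj finj)); congr (_ || (_ && _)).
apply/existsP/existsP.
  case=> y /and3P[/imsetP[x xe ->]]; rewrite -fopp (inj_eq finj) edgeE.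
  by rewrite (inj_eq (imset_inj finj)) => x1 x2; exists x; rewrite xe x1.
case=> x /and3P[xe x1 x2]; exists (f x); rewrite imset_f //=.
by rewrite -fopp (inj_eq finj) edgeE (inj_eq (imset_inj finj)) x1.
Qed.

Lemma ddom_iso d d' : diagram_iso d d' -> ddom d = ddom d'.
Proof.
case=> f [fb fv fopp fsgn [fseq flab _]]; have finj := bij_inj fb.
rewrite /ddom /InG.
have -> : in_legs (@sgn d') = f @: in_legs (@sgn d).
  apply/setP=> y; have [g fK gK] := fb; rewrite -(gK y) (mem_imset _ _ finj).
  by rewrite !inE (leg_iso finj) // fsgn.
rewrite (along_iso finj fopp fseq) => [|x y].
  by rewrite -map_comp; apply: eq_map => h /=; rewrite flab.
by rewrite !inE => /andP[_ ->] /andP[_ ->].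
Qed.

Lemma dcod_iso d d' : diagram_iso d d' -> dcod d = dcod d'.
Proof.
case=> f [fb fv fopp fsgn [fseq flab _]]; have finj := bij_inj fb.
rewrite /dcod /OutG.
have -> : out_legs (@sgn d') = f @: out_legs (@sgn d).
  apply/setP=> y; have [g fK gK] := fb; rewrite -(gK y) (mem_imset _ _ finj).
  by rewrite !inE (leg_iso finj) // fsgn.
rewrite (along_iso finj fopp fseq) => [|x y].
  by rewrite -map_comp; apply: eq_map => h /=; rewrite flab.
by rewrite !inE => /andP[_ /negPf->] /andP[_ /negPf->].
Qed.

End IsoInvariance.

(* The morphisms of F(D): diagrams in D up to isomorphism. *)
Definition Fmor (D : tensor_scheme) : Type := quot (@diagram_iso D).
Definition dclass (D : tensor_scheme) (d : diagram D) : Fmor D :=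
  class (@diagram_iso D) d.
Definition Fdom (D : tensor_scheme) (X : Fmor D) : seq (Ob D) := ddom (repr X).
Definition Fcod (D : tensor_scheme) (X : Fmor D) : seq (Ob D) := dcod (repr X).

Lemma Fdom_class (D : tensor_scheme) (d : diagram D) : Fdom (dclass d) = ddom d.
Proof.
by apply: esym; apply: ddom_iso; apply: (repr_class _ (@diagram_iso_refl D)).
Qed.

Lemma Fcod_class (D : tensor_scheme) (d : diagram D) : Fcod (dclass d) = dcod d.
Proof.
by apply: esym; apply: dcod_iso; apply: (repr_class _ (@diagram_iso_refl D)).
Qed.

Section Operations.
Variable D : tensor_scheme.
Implicit Types d : diagram D.

Definition on_sum (A B C : Type) (f : A -> C) (g : B -> C) (x : A + B) : C :=
  match x with inl a => f a | inr b => g b end.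

(* Signs, labels and decorations of d are inherited from d1 and d2, where j
   identifies the half-edges of d with half-edges of the disjoint union. *)
Definition inherits d1 d2 d (j : d -> d1 + d2) : Prop :=
  [/\ forall h, sgn h = on_sum (@sgn d1) (@sgn d2) (j h),
      forall h, lab h = on_sum (@lab D d1) (@lab D d2) (j h),
      forall v (rv : real_vertex v) (v1 : {set d1}) (rv1 : real_vertex v1),
        j @: v = inl @: v1 -> dec rv = dec rv1 &
      forall v (rv : real_vertex v) (v2 : {set d2}) (rv2 : real_vertex v2),
        j @: v = inr @: v2 -> dec rv = dec rv2].

Definition is_tensor d1 d2 d : Prop :=
  exists j : d -> d1 + d2,
    [/\ bijective j,
        [set j @: v | v : {set d} in verts d] =
          [set inl @: v | v : {set d1} in verts d1] :|:
          [set inr @: v | v : {set d2} in verts d2],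
        forall h, j (opp h) = on_sum (fun a => inl (opp a))
                                     (fun b => inr (opp b)) (j h),
        [seq j @: e | e : {set d} <- edge_seq d] =
          [seq inl @: e | e : {set d1} <- edge_seq d1] ++
          [seq inr @: e | e : {set d2} <- edge_seq d2] &
        inherits j].

Section Composition.
Variables d1 d2 : diagram D.

(* The pairs (o_k, i_k). *)
Definition grafts : seq (d1 * d2) := zip (OutG d1) (InG d2).

(* The half-edges deleted when grafting o to i, and the edge replacing the
   edges of o and i. *)
Definition graft_deleted (p : d1 * d2) : {set d1 + d2} :=
  let: (o, i) := p in
  match virtual_leg o, virtual_leg i with
  | false, false => set0
  | true, false => inl @: edge_of o
  | false, true => inr @: edge_of i
  | true, true => [set inl o; inr i]
  end.

Definition graft_edge (p : d1 * d2) : {set d1 + d2} :=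
  let: (o, i) := p in
  match virtual_leg o, virtual_leg i with
  | false, false => [set inl o; inr i]
  | true, false => [set inr i]
  | false, true => [set inl o]
  | true, true => [set inl (opp o); inr (opp i)]
  end.

Definition deleted : {set d1 + d2} := \bigcup_(p <- grafts) graft_deleted p.

(* The virtual vertices created by grafting two virtual legs. *)
Definition graft_verts : {set {set d1 + d2}} :=
  [set graft_edge p | p in grafts & virtual_leg p.1 && virtual_leg p.2].

(* For t = [:: t_1; ...; t_n] increasing in s, the elements of s strictly
   between t_k and t_(k+1): no lower bound if k = 0, no upper one if k = n. *)
Definition gap (T : eqType) (s t : seq T) (k : nat) : seq T :=
  [seq x <- s | all (fun y => before s y x) (take k t) &&
                all (fun y => before s x y) (drop k t)].

Definition comp_edge_seq : seq {set d1 + d2} :=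
  let os := [seq edge_of o | o <- OutG d1] in
  let js := [seq edge_of i | i <- InG d2] in
  flatten [seq
      [seq inl @: e | e : {set d1} <- gap (edge_seq d1) os kp.1] ++
      graft_edge kp.2 ::
      [seq inr @: e | e : {set d2} <- gap (edge_seq d2) js kp.1.+1]
    | kp <- zip (iota 0 (size grafts)) grafts].

(* d is d2 o d1.  The involution of d is determined by its orbits, which are
   the edges listed by comp_edge_seq. *)
Definition is_comp (d : diagram D) : Prop :=
  dcod d1 = ddom d2 /\
  exists j : d -> d1 + d2,
    [/\ injective j,
        j @: [set: d] = ~: deleted,
        [set j @: v | v : {set d} in verts d] =
          [set inl @: v | v : {set d1} in verts d1 &
             [disjoint (inl @: v : {set d1 + d2}) & deleted]] :|:
          [set inr @: v | v : {set d2} in verts d2 &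
             [disjoint (inr @: v : {set d1 + d2}) & deleted]] :|:
          graft_verts,
        [seq j @: e | e : {set d} <- edge_seq d] = comp_edge_seq &
        inherits j].

End Composition.

Definition tensorF (X1 X2 X : Fmor D) : Prop :=
  is_tensor (repr X1) (repr X2) (repr X).

(* X is X2 o X1. *)
Definition compF (X2 X1 X : Fmor D) : Prop :=
  is_comp (repr X1) (repr X2) (repr X).

End Operations.

Section EmptyDiagram.
Variable D : tensor_scheme.

Let noset (A : {set void}) : A = set0.
Proof. by apply/setP; case. Qed.

Lemma empty_partition : partition (set0 : {set {set void}}) [set: void].
Proof. by rewrite /partition /cover big_set0 /trivIset big_set0 (noset setT) /cover big_set0 cards0 inE !eqxx. Qed.

Definition empty_graph : graph.
Proof.
refine (@Graph void set0 id empty_partition (fun=> erefl) _).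
by move=> v [].
Defined.

Lemma empty_noedge (e : {set empty_graph}) : e \in edges empty_graph = false.
Proof. by apply/negbTE/imsetP => -[[]]. Qed.

Definition empty_planar : planar_graph.
Proof.
refine (@PlanarGraph empty_graph (fun=> true) [::] _ _ erefl _ _ _).
- by case.
- by move=> v; rewrite inE.
- by move=> e; rewrite empty_noedge.
- by move=> e1 e2; rewrite empty_noedge.
- by move=> e1 e2 e3; rewrite empty_noedge.
Defined.

Lemma empty_noreal (v : {set empty_planar}) : ~ real_vertex v.
Proof. by rewrite /real_vertex inE. Qed.

Definition empty_diagram : diagram D.
Proof.
refine (@Diagram D empty_planar (of_void _)
  (fun v rv => False_rect _ (empty_noreal rv)) _ _ _).
- by case.
- by move=> v rv; case: (empty_noreal rv).
- by move=> v rv; case: (empty_noreal rv).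
Defined.

Lemma empty_along (S : {set empty_planar}) : along S = [::].
Proof. by apply/nilP; rewrite /nilp size_sort -cardE (noset S) cards0. Qed.

Lemma ddom_empty : ddom empty_diagram = [::].
Proof. by rewrite /ddom /InG empty_along. Qed.

Lemma dcod_empty : dcod empty_diagram = [::].
Proof. by rewrite /dcod /OutG empty_along. Qed.

End EmptyDiagram.

Lemma setT1_partition (T : finType) :
  0 < #|{: T}| -> partition [set [set: T]] [set: T].
Proof.
move=> T0; rewrite /partition /cover /trivIset /cover !big_set1 !eqxx inE.
by rewrite eq_sym -cards_eq0 cardsT -lt0n.
Qed.

Section UnitaryDiagram.
Variables (D : tensor_scheme) (x : Ob D).

Lemma unitary_virtual_axiom (v : {set bool}) h : v \in [set [set: bool]] ->
  ~~ h != h -> h \in v -> ~~ h \in v -> v = [set h; ~~ h].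
Proof.
by move=> /set1P-> _ _ _; apply/setP => b; rewrite !inE; case: b; case: h.
Qed.

Lemma card_bool_gt0 : 0 < #|{: bool}|. Proof. by rewrite card_bool. Qed.

Definition unitary_g : graph :=
  Graph (setT1_partition card_bool_gt0) negbK unitary_virtual_axiom.

Lemma unitary_edge (h : unitary_g) : edge_of h = setT.
Proof. by apply/setP => b; rewrite !inE; case: b; case: h. Qed.

Lemma unitary_edges : edges unitary_g = [set setT].
Proof.
apply/setP=> e; rewrite inE; apply/imsetP/eqP => [[h _ ->]|->].
  exact: unitary_edge.
by exists true; rewrite ?unitary_edge.
Qed.

Lemma unitary_vertex : virtual ([set: bool] : {set unitary_g}).
Proof.
rewrite /virtual inE eqxx /=; apply/existsP; exists true.
by rewrite unitary_edge eqxx inE.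
Qed.

Definition unitary_planar : planar_graph.
Proof.
refine (@PlanarGraph unitary_g id [:: setT] _ _ erefl _ _ _).
- by case.
- move=> v; rewrite inE => /eqP->; split; apply/set0Pn.
    by exists true; rewrite !inE.
  by exists false; rewrite !inE.
- by move=> e; rewrite unitary_edges !inE.
- by move=> e1 e2; rewrite unitary_edges !inE => /eqP-> /eqP->; rewrite eqxx.
- by move=> e1 e2 e3; rewrite unitary_edges !inE => /eqP-> /eqP->; rewrite eqxx.
Defined.

Lemma unitary_noreal (v : {set unitary_planar}) : ~ real_vertex v.
Proof.
by rewrite /real_vertex inE => /andP[/eqP->]; rewrite unitary_vertex.
Qed.

Definition unitary_diagram : diagram D.
Proof.
refine (@Diagram D unitary_planar (fun=> x)
  (fun v rv => False_rect _ (unitary_noreal rv)) _ _ _).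
- by [].
- by move=> v rv; case: (unitary_noreal rv).
- by move=> v rv; case: (unitary_noreal rv).
Defined.

Lemma unitary_diagramP : unitary_graph unitary_diagram.
Proof. by exists setT; rewrite ?unitary_vertex. Qed.

End UnitaryDiagram.

Section PrimeDiagram.
Variables (D : tensor_scheme) (f : Mor D).

Let m := size (src f).
Let n := size (tgt f).
Local Notation H := ('I_m + 'I_n)%type.

Lemma prime_card_gt0 : 0 < #|{: H}|.
Proof. by rewrite card_sum !card_ord addn_gt0 src_gt0. Qed.

Lemma prime_virtual_axiom (v : {set H}) h : v \in [set [set: H]] ->
  h != h -> h \in v -> h \in v -> v = [set h; h].
Proof. by rewrite eqxx. Qed.

(* The half-edges are the inputs and the outputs, all of them real legs. *)
Definition prime_g : graph :=
  @Graph H _ id (setT1_partition prime_card_gt0) (fun=> erefl)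
    prime_virtual_axiom.

Definition prime_sgn (h : prime_g) : bool := if h is inl _ then true else false.

Definition prime_half_seq : seq prime_g :=
  map inl (enum 'I_m) ++ map inr (enum 'I_n).

Definition prime_edge_seq : seq {set prime_g} := map set1 prime_half_seq.

Lemma prime_edge (h : prime_g) : edge_of h = [set h].
Proof. exact: setUid. Qed.

Lemma prime_edges (e : {set prime_g}) :
  reflect (exists h : prime_g, e = [set h]) (e \in edges prime_g).
Proof.
apply: (iffP imsetP) => [[h _ ->]|[h ->]]; by exists h; rewrite ?prime_edge.
Qed.

Lemma prime_half_seq_uniq : uniq prime_half_seq.
Proof.
rewrite cat_uniq (map_inj_uniq (@inl_inj _ _)) (map_inj_uniq (@inr_inj _ _)).
rewrite !enum_uniq andbT /=.
by apply/hasPn => _ /mapP[j _ ->]; apply/mapP => -[].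
Qed.

Lemma mem_prime_half_seq (h : prime_g) : h \in prime_half_seq.
Proof.
by rewrite mem_cat; case: h => i; rewrite map_f ?orbT // mem_enum.
Qed.

Lemma prime_index (h : prime_g) : index [set h] prime_edge_seq =
  if h is inr j then m + j else if h is inl i then i : nat else 0.
Proof.
rewrite (index_map (@set1_inj _)) /prime_half_seq index_cat; case: h => [i|j].
  rewrite map_f ?mem_enum // index_map; last exact: inl_inj.
  exact: index_enum_ord.
have -> : (inr j \in [seq (inl i : prime_g) | i <- enum 'I_m]) = false.
  by apply/mapP => -[].
rewrite size_map size_enum_ord index_map; last by move=> ? ? [].
by rewrite index_enum_ord.
Qed.

Lemma prime_step (h h' : prime_g) :
  step prime_sgn [set h] [set h'] = prime_sgn h && ~~ prime_sgn h'.
Proof.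
rewrite /step.
have -> : [set h] \in edges prime_g by apply/prime_edges; exists h.
have -> : [set h'] \in edges prime_g by apply/prime_edges; exists h'.
apply/existsP/andP => /=.
  case=> v /andP[/andP[_ /existsP[y /and3P[]]]].
  rewrite inE => /eqP-> hs _ /andP[_ /existsP[z /and3P[]]].
  by rewrite inE => /eqP->.
case=> hs hs'; exists setT; rewrite /target /source !inE eqxx /=.
by apply/andP; split; apply/existsP; [exists h | exists h'];
  rewrite !inE eqxx ?hs ?hs'.
Qed.

Lemma prime_reach (h h' : prime_g) : h != h' ->
  reach prime_sgn [set h] [set h'] = prime_sgn h && ~~ prime_sgn h'.
Proof.
move=> hh'; rewrite -prime_step; apply/idP/idP; last exact: connect1.
case/connectP=> p; elim/last_ind: p => [_ /set1_inj /eqP|].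
  by rewrite eq_sym (negPf hh').
move=> p e _; rewrite last_rcons rcons_path => /andP[pp st] ?; subst e.
case: p pp st => [//|e1 p] /= /andP[st1 _] st.
have /prime_edges[h1 E1] : e1 \in edges prime_g by case/and3P: st1.
have /prime_edges[h2 E2] : last e1 p \in edges prime_g by case/and3P: st.
move: st1 st; rewrite E2 E1 !prime_step.
by case/andP=> -> _ /andP[_ ->].
Qed.

Lemma prime_before (h h' : prime_g) : prime_sgn h -> ~~ prime_sgn h' ->
  before prime_edge_seq [set h] [set h'].
Proof.
rewrite /before !prime_index; case: h => [i|//] _; case: h' => [//|j] _.
exact: leq_trans (ltn_ord i) (leq_addr _ _).
Qed.

Definition prime_planar : planar_graph.
Proof.
refine (@PlanarGraph prime_g prime_sgn prime_edge_seq _ _ _ _ _ _).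
- by move=> h; rewrite eqxx.
- move=> v; rewrite inE => /eqP->; split; apply/set0Pn.
    by exists (inl (Ordinal (src_gt0 f))); rewrite !inE.
  by exists (inr (Ordinal (tgt_gt0 f))); rewrite !inE.
- by rewrite (map_inj_uniq (@set1_inj _)) prime_half_seq_uniq.
- move=> e; apply/mapP/prime_edges => -[h]; first by exists h.
  by move->; exists h; rewrite ?mem_prime_half_seq.
- move=> _ _ /prime_edges[h ->] /prime_edges[h' ->].
  rewrite (inj_eq (@set1_inj _)) => hh'; rewrite (prime_reach hh').
  by case/andP; apply: prime_before.
- move=> _ _ _ /prime_edges[h ->] /prime_edges[h' ->] /prime_edges[k ->].
  rewrite !(inj_eq (@set1_inj _)) => /and3P[hh' hk kh'].
  by rewrite !prime_reach // => /andP[-> ->] _ _; case: (prime_sgn k).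
Defined.

Lemma prime_along_in (S : {set prime_planar}) :
  (forall h, h \in S = prime_sgn h) -> along S = map inl (enum 'I_m).
Proof.
move=> SE; apply: (@sort_keyE _ (@pos prime_planar)).
  apply: uniq_perm; rewrite ?(map_inj_uniq (@inl_inj _ _)) ?enum_uniq //.
  move=> h; rewrite mem_enum SE; case: h => [i|j] /=.
    by rewrite map_f // mem_enum.
  by apply/mapP => -[].
rewrite -map_comp (@eq_map _ _ _ val) ?val_enum_ord ?iota_ltn_sorted //.
by move=> i /=; rewrite /pos prime_edge prime_index.
Qed.

Lemma prime_along_out (S : {set prime_planar}) :
  (forall h, h \in S = ~~ prime_sgn h) -> along S = map inr (enum 'I_n).
Proof.
move=> SE; apply: (@sort_keyE _ (@pos prime_planar)).
  apply: uniq_perm; rewrite ?(map_inj_uniq (@inr_inj _ _)) ?enum_uniq //.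
  move=> h; rewrite mem_enum SE; case: h => [i|j] /=.
    by apply/mapP => -[].
  by rewrite map_f // mem_enum.
rewrite -map_comp (@eq_map _ _ _ (addn m \o val)); last first.
  by move=> i /=; rewrite /pos prime_edge prime_index.
by rewrite map_comp val_enum_ord -iotaDl addn0 iota_ltn_sorted.
Qed.

Definition prime_lab (h : prime_planar) : Ob D :=
  match h with
  | inl i => tnth (in_tuple (src f)) i
  | inr j => tnth (in_tuple (tgt f)) j
  end.

Lemma prime_lab_in : map prime_lab (map inl (enum 'I_m)) = src f.
Proof. rewrite -map_comp; exact: (map_tnth_enum (in_tuple (src f))). Qed.

Lemma prime_lab_out : map prime_lab (map inr (enum 'I_n)) = tgt f.
Proof. rewrite -map_comp; exact: (map_tnth_enum (in_tuple (tgt f))). Qed.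

Definition prime_diagram : diagram D.
Proof.
refine (@Diagram D prime_planar prime_lab (fun _ _ => f) _ _ _).
- by [].
- move=> v /andP[]; rewrite inE => /eqP-> _.
  by rewrite /In prime_along_in ?prime_lab_in // => h; rewrite !inE.
- move=> v /andP[]; rewrite inE => /eqP-> _.
  by rewrite /Out prime_along_out ?prime_lab_out // => h; rewrite !inE.
Defined.

Lemma ddom_prime : ddom prime_diagram = src f.
Proof.
rewrite /ddom /InG prime_along_in ?prime_lab_in // => h.
by rewrite !inE /leg eqxx.
Qed.

Lemma dcod_prime : dcod prime_diagram = tgt f.
Proof.
rewrite /dcod /OutG prime_along_out ?prime_lab_out // => h.
by rewrite !inE /leg eqxx.
Qed.

Lemma prime_diagramP : prime_graph prime_diagram.
Proof.
split=> [|[v _ /andP[_ /existsP[h /and3P[_]]]]]; first exact: cards1.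
by rewrite eqxx.
Qed.

End PrimeDiagram.

(* (w_1 ... w_m; u_1 ... u_n; Gamma) *)
Record bracketed (D : tensor_scheme) := Bracketed {
  bdom : seq (seq (Ob D));
  bcod : seq (seq (Ob D));
  bdiag : Fmor D;
  bdom_gt0 : 0 < size bdom;
  bcod_gt0 : 0 < size bcod;
  Fdom_bdiag : Fdom bdiag = flatten bdom;
  Fcod_bdiag : Fcod bdiag = flatten bcod
}.

Definition T (D : tensor_scheme) : tensor_scheme :=
  TensorScheme (@bdom_gt0 D) (@bcod_gt0 D).

Section Functor.
Variables (C D : tensor_scheme) (phi : scheme_hom C D).

Lemma relabel_src (d : diagram C) (v : {set d}) (rv : real_vertex v) :
  src (hom_mor phi (dec rv)) = map (hom_ob phi \o @lab C d) (In v).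
Proof. by rewrite hom_src dec_src map_comp. Qed.

Lemma relabel_tgt (d : diagram C) (v : {set d}) (rv : real_vertex v) :
  tgt (hom_mor phi (dec rv)) = map (hom_ob phi \o @lab C d) (Out v).
Proof. by rewrite hom_tgt dec_tgt map_comp. Qed.

Definition relabel (d : diagram C) : diagram D :=
  @Diagram D d (hom_ob phi \o @lab C d)
    (fun v (rv : real_vertex v) => hom_mor phi (dec rv))
    (fun h => congr1 (hom_ob phi) (lab_opp h))
    (@relabel_src d) (@relabel_tgt d).

Definition Frelabel (X : Fmor C) : Fmor D := dclass (relabel (repr X)).

Lemma Fdom_relabel X : Fdom (Frelabel X) = map (hom_ob phi) (Fdom X).
Proof. by rewrite Fdom_class /Fdom /ddom -map_comp. Qed.

Lemma Fcod_relabel X : Fcod (Frelabel X) = map (hom_ob phi) (Fcod X).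
Proof. by rewrite Fcod_class /Fcod /dcod -map_comp. Qed.

Lemma relabel_domP (b : bracketed C) :
  Fdom (Frelabel (bdiag b)) = flatten (map (map (hom_ob phi)) (bdom b)).
Proof. by rewrite Fdom_relabel Fdom_bdiag map_flatten. Qed.

Lemma relabel_codP (b : bracketed C) :
  Fcod (Frelabel (bdiag b)) = flatten (map (map (hom_ob phi)) (bcod b)).
Proof. by rewrite Fcod_relabel Fcod_bdiag map_flatten. Qed.

Lemma relabel_gt0 (s : seq (seq (Ob C))) :
  0 < size s -> 0 < size (map (map (hom_ob phi)) s).
Proof. by rewrite size_map. Qed.

Definition brelabel (b : bracketed C) : bracketed D :=
  Bracketed (relabel_gt0 (bdom_gt0 b)) (relabel_gt0 (bcod_gt0 b))
    (relabel_domP b) (relabel_codP b).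

Definition T_hom : scheme_hom (T C) (T D) :=
  @SchemeHom (T C) (T D) (map (hom_ob phi)) brelabel
    (fun=> erefl) (fun=> erefl).

End Functor.

Definition Fempty (D : tensor_scheme) : Fmor D := dclass (empty_diagram D).
Definition Funit (D : tensor_scheme) (x : Ob D) : Fmor D :=
  dclass (unitary_diagram x).
Definition Fprime (D : tensor_scheme) (f : Mor D) : Fmor D :=
  dclass (prime_diagram f).

Section Unit.
Variable D : tensor_scheme.

(* Gamma_f, with its domain and codomain bracketed as ws and us. *)
Definition bprime (f : Mor D) (ws us : seq (seq (Ob D)))
    (ws0 : 0 < size ws) (us0 : 0 < size us)
    (fw : src f = flatten ws) (fu : tgt f = flatten us) : bracketed D :=
  @Bracketed D ws us (Fprime f) ws0 us0
    (etrans (etrans (Fdom_class _) (ddom_prime f)) fw)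
    (etrans (etrans (Fcod_class _) (dcod_prime f)) fu).

Lemma singletons_gt0 (S : Type) (s : seq S) :
  0 < size s -> 0 < size [seq [:: x] | x <- s].
Proof. by rewrite size_map. Qed.

Definition eta_mor (f : Mor D) : bracketed D :=
  bprime (singletons_gt0 (src_gt0 f)) (singletons_gt0 (tgt_gt0 f))
    (esym (flatten_seq1 _)) (esym (flatten_seq1 _)).

Definition eta : scheme_hom D (T D) :=
  @SchemeHom D (T D) (fun x => [:: x]) eta_mor (fun=> erefl) (fun=> erefl).

(* The empty diagram, with domain and codomain bracketed as one empty word. *)
Definition bempty : bracketed D :=
  @Bracketed D [:: [::]] [:: [::]] (Fempty D) isT isT
    (etrans (Fdom_class _) (ddom_empty D))
    (etrans (Fcod_class _) (dcod_empty D)).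

End Unit.

(* X is the identity of w: the tensor product of the unitary diagrams of the
   letters of w. *)
Inductive is_identity (D : tensor_scheme) : seq (Ob D) -> Fmor D -> Prop :=
| IdentityNil : is_identity [::] (Fempty D)
| IdentityCons x w X Y :
    is_identity w X -> tensorF (Funit x) X Y -> is_identity (x :: w) Y.

(* value X Y: Y is obtained by tensoring and composing in F(D), as prescribed
   by the diagram X in T(D), the diagrams decorating the vertices of X. *)
Inductive value (D : tensor_scheme) : Fmor (T D) -> Fmor D -> Prop :=
| ValueEmpty : value (Fempty (T D)) (Fempty D)
| ValueUnit (w : Ob (T D)) Y : is_identity w Y -> value (Funit w) Y
| ValuePrime (b : Mor (T D)) : value (Fprime b) (bdiag b)
| ValueTensor X1 X2 X Y1 Y2 Y :
    value X1 Y1 -> value X2 Y2 ->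
    tensorF X1 X2 X -> tensorF Y1 Y2 Y -> value X Y
| ValueComp X1 X2 X Y1 Y2 Y :
    value X1 Y1 -> value X2 Y2 ->
    compF X2 X1 X -> compF Y2 Y1 Y -> value X Y.

Definition mu_ob (D : tensor_scheme) : Ob (T (T D)) -> Ob (T D) := @flatten _.

(* mu_mor M b: mu sends M to b.  Only the graph of mu is needed: that F(D) is
   free, so that value is a function, is not proved here. *)
Definition mu_mor (D : tensor_scheme) (M : Mor (T (T D))) (b : Mor (T D)) :=
  [/\ bdom b = map (@mu_ob D) (bdom M), bcod b = map (@mu_ob D) (bcod M) &
      value (bdiag M) (bdiag b)].

Record tensor_manifold := TensorManifold {
  tm_scheme :> tensor_scheme;
  eps : scheme_hom (T tm_scheme) tm_scheme;
  eps_mu_ob : forall W : Ob (T (T tm_scheme)),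
    hom_ob eps (hom_ob (T_hom eps) W) = hom_ob eps (mu_ob W);
  eps_mu_mor : forall (M : Mor (T (T tm_scheme))) (b : Mor (T tm_scheme)),
    mu_mor M b -> hom_mor eps (hom_mor (T_hom eps) M) = hom_mor eps b;
  eps_eta_ob : forall x : Ob tm_scheme,
    hom_ob eps (hom_ob (eta tm_scheme) x) = x;
  eps_eta_mor : forall f : Mor tm_scheme,
    hom_mor eps (hom_mor (eta tm_scheme) f) = f
}.

(* A linear partition of the ordered set listed by s: the ordered list of its
   blocks, each block being the ordered list of its elements. *)
Record linear_partition (A : eqType) (s : seq A) := LinearPartition {
  blocks : seq (seq A);
  underlying_uniq : uniq s;
  flatten_blocks : flatten blocks = s;
  blocks_nonempty : all (fun b => b != [::]) blocks
}.

Definition nb_elements (A : eqType) (s : seq A) (I : linear_partition s) : nat :=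
  size s.

Section Refine.
Variables (A : eqType) (s : seq A) (Q : linear_partition s).
Variable P : linear_partition (blocks Q).

Lemma flatten_triangle : flatten (map flatten (blocks P)) = s.
Proof.
rewrite -[RHS](flatten_blocks Q) -[in RHS](flatten_blocks P).
by elim: (blocks P) => //= bs bss ->; rewrite flatten_cat.
Qed.

Lemma triangle_nonempty :
  all (fun b => b != [::]) (map flatten (blocks P)).
Proof.
apply/allP=> _ /mapP[bs bsP ->].
have : bs != [::] by apply: (allP (blocks_nonempty P)).
case: bs bsP => [//|b bs] bsP _.
have : b != [::].
  apply: (allP (blocks_nonempty Q)); rewrite -(flatten_blocks P).
  by apply/flattenP; exists (b :: bs); rewrite ?mem_head.
by case: b bsP.
Qed.

(* The blocks are the unions of the blocks of Q in a common block of P. *)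
Definition triangle : linear_partition s :=
  LinearPartition (underlying_uniq Q) flatten_triangle triangle_nonempty.

End Refine.

Section Fusion.
Variables (D : tensor_manifold) (A B : eqType) (s : seq A) (t : seq B).
Variables (I : linear_partition s) (O : linear_partition t).

(* The word w cut into consecutive words according to I. *)
Definition bracket (E : eqType) (r : seq E) (J : linear_partition r) (S : Type)
    (w : seq S) : seq (seq S) := reshape (shape (blocks J)) w.

Lemma flatten_bracket (E : eqType) (r : seq E) (J : linear_partition r)
  (S : Type) (w : seq S) : size w = nb_elements J -> w = flatten (bracket J w).
Proof.
by move=> wJ; rewrite reshapeKr // wJ -size_flatten flatten_blocks.
Qed.

Lemma bracket_gt0 (E : eqType) (r : seq E) (J : linear_partition r)
  (S : Type) (w : seq S) :
  0 < size w -> size w = nb_elements J -> 0 < size (bracket J w).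
Proof.
move=> w0 wJ; have := flatten_bracket wJ.
by case: (bracket J w) => // w_nil; rewrite w_nil in w0.
Qed.

Definition fusion (f : Mor D) : Mor D :=
  match size (src f) =P nb_elements I, size (tgt f) =P nb_elements O with
  | ReflectT fI, ReflectT fO =>
      hom_mor (eps D)
        (bprime (bracket_gt0 (src_gt0 f) fI) (bracket_gt0 (tgt_gt0 f) fO)
           (flatten_bracket fI) (flatten_bracket fO))
  | _, _ => hom_mor (eps D) (bempty D)
  end.

End Fusion.

Arguments fusion D {A B s t} I O f.

(* Main.v *)
Require Import Defs.
From mathcomp Require Import all_boot.
From mathcomp Require Import boolp.

Set Implicit Arguments.
Unset Strict Implicit.
Unset Printing Implicit Defensive.

(** Fusing twice amounts to evaluating one prime diagram in two ways.

    Suppose first that the sizes of [I2] and [O2] fit [f].  Cut the source and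
    the target of [f] along [I2] and [O2]: this makes the prime diagram of [f]
    a morphism [b] of [T D], and the inner fusion sends [f] to [eps b].  Cut
    the source and the target of [b] along [I1] and [O1]: the prime diagram of
    [b] becomes a morphism [M] of [T (T D)], whose two images under
    [T eps] and [mu] are
    - the prime diagram of [eps b], bracketed by [I1] and [O1], because
      relabelling a prime diagram relabels its vertex ([Frelabel_prime]);
    - the prime diagram of [f], bracketed by [triangle I1] and [triangle O1],
      because the value of a prime diagram is the diagram that decorates it and
      because concatenating brackets is forming [triangle]
      ([bracket_triangle]).
    The law [eps \o T eps = eps \o mu] at [M] is then the claim
    ([fusion_bprime]).

    If the sizes do not fit, the inner fusion and the right-hand side are both
    [Id_1], the image of the empty diagram; its source and target have one
    letter each.  The outer fusion either sends it to [Id_1] by default, or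
    cuts two one-letter words into nonempty blocks; this brackets the prime
    diagram of [Id_1] as the unit [eta] does, so that the law
    [eps \o eta = Id] returns [Id_1] again ([fusion_unit]). *)

(** * Isomorphism of diagrams is an equivalence *)

Section IsoEquivalence.
Variable D : tensor_scheme.
Implicit Types d : diagram D.

Lemma dec_congr d (v w : {set d}) (rv : real_vertex v) (rw : real_vertex w) :
  v = w -> dec rv = dec rw.
Proof. by move=> e; subst w; congr (dec _); apply: bool_irrelevance. Qed.

(** An isomorphism compares decorations only at a vertex already known to be
    real on both sides; composing isomorphisms needs this at the middle. *)
Lemma real_vertex_iso d d' (f : d -> d') :
  injective f -> (forall h, f (opp h) = opp (f h)) ->
  verts d' = [set f @: v | v : {set d} in verts d] ->
  forall v : {set d}, real_vertex (f @: v) = real_vertex v.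
Proof.
move=> finj fopp fv v.
have edgeE x : edge_of (f x) = f @: edge_of x.
  by rewrite /edge_of -fopp imsetU !imset_set1.
rewrite /real_vertex /virtual fv (mem_imset _ _ (imset_inj finj)).
congr (_ && ~~ (_ && _)); apply/existsP/existsP.
  case=> _ /and3P[/imsetP[x xv ->]].
  rewrite -fopp (inj_eq finj) edgeE (inj_eq (imset_inj finj)) => x1 x2.
  by exists x; rewrite xv x1.
case=> x /and3P[xv x1 x2]; exists (f x); rewrite imset_f //=.
by rewrite -fopp (inj_eq finj) edgeE (inj_eq (imset_inj finj)) x1.
Qed.

Lemma diagram_iso_sym d d' : diagram_iso d d' -> diagram_iso d' d.
Proof.
case=> f [[g fK gK] fv fopp fsgn [fseq flab fdec]].
have imK (A : {set d}) : g @: (f @: A) = A.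
  by rewrite -imset_comp (eq_imset _ fK) imset_id.
have imK' (A : {set d'}) : f @: (g @: A) = A.
  by rewrite -imset_comp (eq_imset _ gK) imset_id.
exists g; split.
- by exists f.
- by rewrite fv -imset_comp (eq_imset (g := id)) ?imset_id.
- by move=> h; rewrite -[in LHS](gK h) -fopp fK.
- by move=> h; rewrite -fsgn gK.
split.
- by rewrite fseq -map_comp map_id_in // => e _; apply: imK.
- by move=> h; rewrite -flab gK.
move=> v rv rgv.
have rfgv : real_vertex (f @: (g @: v)) by rewrite imK'.
by rewrite -(fdec _ rgv rfgv); apply: dec_congr.
Qed.

Lemma diagram_iso_trans d1 d2 d3 :
  diagram_iso d1 d2 -> diagram_iso d2 d3 -> diagram_iso d1 d3.
Proof.
case=> f [fb fv fopp fsgn [fseq flab fdec]].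
case=> g [gb gv gopp gsgn [gseq glab gdec]].
have im (A : {set d1}) : (g \o f) @: A = g @: (f @: A) by rewrite imset_comp.
exists (g \o f); split.
- exact: bij_comp.
- rewrite gv fv -imset_comp; apply: eq_imset => A /=; exact/esym/im.
- by move=> h /=; rewrite fopp gopp.
- by move=> h /=; rewrite gsgn fsgn.
split.
- by rewrite gseq fseq -map_comp; apply: eq_map => A /=; rewrite im.
- by move=> h /=; rewrite glab flab.
move=> v rv rv'.
have rfv : real_vertex (f @: v) by rewrite (real_vertex_iso (bij_inj fb)).
have rgfv : real_vertex (g @: (f @: v)) by rewrite -im.
by rewrite (dec_congr rv' rgfv (im v)) (gdec _ rfv) (fdec _ rv).
Qed.

Lemma dclass_eq d d' : diagram_iso d d' -> dclass d = dclass d'.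
Proof.
move=> dd'.
have E : diagram_iso d = diagram_iso d'.
  apply/funext => x; apply/propext; split.
    exact/diagram_iso_trans/diagram_iso_sym.
  exact: diagram_iso_trans.
rewrite /dclass /class; move: (ex_intro _ d _) (ex_intro _ d' _).
by rewrite E => p q; congr Quot; apply: Prop_irrelevance.
Qed.

Lemma bracketed_eq (b b' : bracketed D) :
  bdom b = bdom b' -> bcod b = bcod b' -> bdiag b = bdiag b' -> b = b'.
Proof.
case: b b' => [w u X w0 u0 wX uX] [w' u' X' w0' u0' wX' uX'] /= ew eu eX.
by subst; congr Bracketed; apply: Prop_irrelevance.
Qed.

End IsoEquivalence.

(** * Relabelling prime diagrams *)

Section Relabelling.
Variables (C D : tensor_scheme) (phi : scheme_hom C D).

Lemma relabel_iso (d d' : diagram C) :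
  diagram_iso d d' -> diagram_iso (relabel phi d) (relabel phi d').
Proof.
case=> f [fb fv fopp fsgn [fseq flab fdec]].
exists f; split=> //; split=> // [h|v rv rv'] /=; first by rewrite flab.
by rewrite (fdec v rv rv').
Qed.

Lemma Frelabel_class (d : diagram C) :
  Frelabel phi (dclass d) = dclass (relabel phi d).
Proof.
apply/dclass_eq/relabel_iso/diagram_iso_sym.
exact: (repr_class _ (@diagram_iso_refl C)).
Qed.

(** The two diagrams agree except that their half-edges are indexed by words
    whose lengths are equal only up to a proof; hence the casts. *)
Lemma relabel_prime_iso (b : Mor C) :
  diagram_iso (relabel phi (prime_diagram b)) (prime_diagram (hom_mor phi b)).
Proof.
have em : size (src b) = size (src (hom_mor phi b)).
  by rewrite hom_src size_map.
have en : size (tgt b) = size (tgt (hom_mor phi b)).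
  by rewrite hom_tgt size_map.
pose f (h : relabel phi (prime_diagram b)) : prime_diagram (hom_mor phi b) :=
  match h with
  | inl i => inl (cast_ord em i)
  | inr j => inr (cast_ord en j)
  end.
have fb : bijective f.
  exists (fun h => match h with
    | inl i => inl (cast_ord (esym em) i)
    | inr j => inr (cast_ord (esym en) j)
    end); by case=> k /=; rewrite ?cast_ordK ?cast_ordKV.
exists f; split=> //.
- rewrite /= imset_set1; congr [set _]; apply/setP => h; rewrite inE.
  by have [g _ gK] := fb; rewrite -(gK h) imset_f.
- by case.
split=> //.
- have imE (k l : nat) (e : k = l) :
      enum 'I_l = [seq cast_ord e i | i <- enum 'I_k].
    case: l / e; rewrite map_id_in // => i _; exact: cast_ord_id.
  rewrite /= /prime_edge_seq -map_comp (eq_map (g := set1 \o f)); last first.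
    by move=> h /=; rewrite imset_set1.
  rewrite map_comp; congr map; rewrite /prime_half_seq map_cat.
  by rewrite (imE _ _ em) (imE _ _ en) -!map_comp; congr cat; apply: eq_map.
- case=> k /=.
    pose x0 := lab (inl k : prime_diagram b).
    rewrite !(tnth_nth (hom_ob phi x0)) /= hom_src (nth_map x0) //.
    by rewrite -(tnth_nth x0 (in_tuple _)).
  pose x0 := lab (inr k : prime_diagram b).
  rewrite !(tnth_nth (hom_ob phi x0)) /= hom_tgt (nth_map x0) //.
  by rewrite -(tnth_nth x0 (in_tuple _)).
Qed.

Lemma Frelabel_prime (b : Mor C) :
  Frelabel phi (Fprime b) = Fprime (hom_mor phi b).
Proof. by rewrite Frelabel_class; apply/dclass_eq/relabel_prime_iso. Qed.

End Relabelling.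

(** * Cutting words *)

Section Brackets.
Variables (A : eqType) (s : seq A).

Lemma map_bracket (S S' : Type) (g : S -> S') (J : linear_partition s) w :
  bracket J (map g w) = map (map g) (bracket J w).
Proof.
rewrite /bracket; elim: (shape _) w => //= n sh IH w.
by rewrite -map_take -map_drop IH.
Qed.

Lemma size_bracket (S : Type) (J : linear_partition s) (w : seq S) :
  size (bracket J w) = size (blocks J).
Proof. by rewrite size_reshape size_map. Qed.

Lemma bracket_triangle (Q : linear_partition s)
    (P : linear_partition (blocks Q)) (S : Type) (w : seq S) :
  bracket (triangle P) w = map flatten (bracket P (bracket Q w)).
Proof.
have flattenS (bs bss : seq (seq A)) (u : seq S) :
    flatten (take (size bs) (reshape (shape (bs ++ bss)) u)) =
      take (sumn (shape bs)) u /\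
    drop (size bs) (reshape (shape (bs ++ bss)) u) =
      reshape (shape bss) (drop (sumn (shape bs)) u).
  elim: bs u => [|b bs IH] u /=; first by rewrite ?take0 ?drop0.
  have [-> ->] := IH (drop (size b) u).
  by rewrite -takeD drop_drop addnC.
rewrite /bracket /=; move: (blocks P) (flatten_blocks P) => bss <-.
elim: bss w => //= bs bss IH w.
have [-> ->] := flattenS bs (flatten bss) w.
by rewrite IH size_flatten.
Qed.

(** A one-letter word has only one cut into nonempty blocks. *)
Lemma bracket_letter (J : linear_partition s) (S : Type) (x : S) :
  size [:: x] = nb_elements J -> bracket J [:: x] = [:: [:: x]].
Proof.
rewrite /nb_elements /bracket -[in size s](flatten_blocks J).
have := blocks_nonempty J.
by case: (blocks J) => [|[|a [|a' b]] [|[|c c'] bs]].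
Qed.

End Brackets.

(** * Fusion *)

Section FusionOfBrackets.
Variables (D : tensor_manifold) (A B : eqType) (s : seq A) (t : seq B).
Variables (I : linear_partition s) (O : linear_partition t).

Lemma fusion_fit (f : Mor D) (ws us : seq (seq (Ob D)))
    (ws0 : 0 < size ws) (us0 : 0 < size us)
    (fw : src f = flatten ws) (fu : tgt f = flatten us) :
  size (src f) = nb_elements I -> size (tgt f) = nb_elements O ->
  ws = bracket I (src f) -> us = bracket O (tgt f) ->
  fusion D I O f = hom_mor (eps D) (bprime ws0 us0 fw fu).
Proof.
move=> fI fO wsE usE; rewrite /fusion; case: eqP => // fI'; case: eqP => // fO'.
by congr hom_mor; apply: bracketed_eq.
Qed.

Lemma fusion_unfit (f : Mor D) :
  ~ (size (src f) = nb_elements I /\ size (tgt f) = nb_elements O) ->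
  fusion D I O f = hom_mor (eps D) (bempty D).
Proof. by rewrite /fusion; case: eqP => // fI; case: eqP => // fO []. Qed.

Lemma fusion_unit :
  fusion D I O (hom_mor (eps D) (bempty D)) = hom_mor (eps D) (bempty D).
Proof.
set g := hom_mor _ _.
have gs : src g = [:: hom_ob (eps D) [::]] by rewrite hom_src.
have gt : tgt g = [:: hom_ob (eps D) [::]] by rewrite hom_tgt.
have [[gI gO]|] := EM (size (src g) = nb_elements I /\
                       size (tgt g) = nb_elements O); last exact: fusion_unfit.
rewrite -[RHS]eps_eta_mor; apply: fusion_fit => //.
- by rewrite gs in gI *; rewrite bracket_letter.
- by rewrite gt in gO *; rewrite bracket_letter.
Qed.

End FusionOfBrackets.

(** The law [eps \o T eps = eps \o mu] at the prime diagram of a prime diagram: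
    [ws] and [us] are the brackets of [f], which [I] and [O] group further. *)
Lemma fusion_bprime (D : tensor_manifold) (A B : eqType) (s : seq A)
    (t : seq B) (I : linear_partition s) (O : linear_partition t) (f : Mor D)
    (ws us : seq (seq (Ob D))) (ws0 : 0 < size ws) (us0 : 0 < size us)
    (fw : src f = flatten ws) (fu : tgt f = flatten us)
    (b : Mor (T D)) :
  size ws = nb_elements I -> size us = nb_elements O ->
  bdom b = map flatten (bracket I ws) -> bcod b = map flatten (bracket O us) ->
  bdiag b = Fprime f ->
  fusion D I O (hom_mor (eps D) (bprime ws0 us0 fw fu)) = hom_mor (eps D) b.
Proof.
move=> wI uO bw bu bf; set b0 := bprime ws0 us0 fw fu.
pose M := @bprime (T D) b0 (bracket I ws) (bracket O us)
  (bracket_gt0 ws0 wI) (bracket_gt0 us0 uO)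
  (flatten_bracket wI) (flatten_bracket uO).
have <- : hom_mor (eps D) (hom_mor (T_hom (eps D)) M) = hom_mor (eps D) b.
  by apply: eps_mu_mor; split; rewrite // bf; apply: (@ValuePrime D b0).
have gI : size (src (hom_mor (eps D) b0)) = nb_elements I.
  by rewrite hom_src size_map.
have gO : size (tgt (hom_mor (eps D) b0)) = nb_elements O.
  by rewrite hom_tgt size_map.
rewrite (fusion_fit (bracket_gt0 (src_gt0 _) gI) (bracket_gt0 (tgt_gt0 _) gO)
  (flatten_bracket gI) (flatten_bracket gO)) //.
congr hom_mor; apply: bracketed_eq => /=.
- by rewrite hom_src map_bracket.
- by rewrite hom_tgt map_bracket.
- by rewrite Frelabel_prime.
Qed.

Theorem proposition6p2p4 (D : tensor_manifold)
  (A B : eqType) (s : seq A) (t : seq B)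
  (I2 : linear_partition s) (O2 : linear_partition t)
  (I1 : linear_partition (blocks I2)) (O1 : linear_partition (blocks O2)) :
  fusion D I1 O1 \o fusion D I2 O2 = fusion D (triangle I1) (triangle O1).
Proof.
apply/funext => f /=.
have [[fI fO]|unfit] := EM (size (src f) = nb_elements I2 /\
                            size (tgt f) = nb_elements O2); last first.
  (* [triangle] does not change the underlying set. *)
  rewrite (fusion_unfit unfit) fusion_unit.
  by rewrite (fusion_unfit (I := triangle I1) (O := triangle O1)).
rewrite (fusion_fit (bracket_gt0 (src_gt0 f) fI) (bracket_gt0 (tgt_gt0 f) fO)
  (flatten_bracket fI) (flatten_bracket fO)) //.
have fI' : size (src f) = nb_elements (triangle I1) by [].
have fO' : size (tgt f) = nb_elements (triangle O1) by [].
rewrite (fusion_fit (bracket_gt0 (src_gt0 f) fI') (bracket_gt0 (tgt_gt0 f) fO')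
  (flatten_bracket fI') (flatten_bracket fO')) //.
by apply: fusion_bprime; rewrite ?size_bracket //= bracket_triangle.
Qed.
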